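(* Let $U,\mu,\sigma,\mathcal{L}_0,\mathcal{L}_\sigma$ be as in the context. For every $g\in C_c^3(\mathbb{R}^d)$, $$\|\mathcal{L}_\sigma g\|_{L^2(\mu)}^2=\int_{\mathbb{R}^d}\sigma^4\langle\nabla g,\nabla^2U\,\nabla g\rangle\,d\mu+\int_{\mathbb{R}^d}\sigma^4|\nabla^2g|_F^2\,d\mu+\int_{\mathbb{R}^d}\Theta(g,\sigma)\,d\mu,$$ where $$\begin{aligned}\Theta(g,\sigma):={}&4\sigma^3\langle\nabla\sigma,\nabla^2g\,\nabla g\rangle+3\sigma^2|\nabla\sigma|^2|\nabla g|^2-\sigma^3|\nabla g|^2\langle\nabla\sigma,\nabla U\rangle+\sigma^3|\nabla g|^2\Delta\sigma\\&-2\sigma^3\langle\nabla g,\nabla\sigma\rangle\mathcal{L}_0g-2\sigma^2\langle\nabla g,\nabla\sigma\rangle^2-2\sigma^3\langle\nabla g,\nabla^2\sigma\,\nabla g\rangle.\end{aligned}$$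
   Context: Let $d\ge1$ and let $U:\mathbb{R}^d\to\mathbb{R}$ be smooth with $Z_U:=\int e^{-U(x)}dx\in(0,\infty)$; $\mu(dx):=Z_U^{-1}e^{-U(x)}dx$. Let $\sigma:\mathbb{R}^d\to[1,\infty)$ be smooth and Lipschitz. For a differentiable vector field $F$ on $\mathbb{R}^d$, $\nabla^\star F:=-\mathrm{div}F+\langle\nabla U,F\rangle$. For $g\in C^2(\mathbb{R}^d)$, $\mathcal{L}_\sigma g:=-\nabla^\star(\sigma^2\nabla g)$ and $\mathcal{L}_0g:=-\nabla^\star\nabla g=\Delta g-\langle\nabla U,\nabla g\rangle$. $|A|_F:=\sqrt{\mathrm{Trace}(A^TA)}$; $\nabla^2$ is the Hessian. $C_c^3$: compactly supported $C^3$ functions. *)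

(* Defs.v *)
From HB Require Import structures.
From mathcomp Require Import all_boot all_order all_algebra.
From mathcomp Require Import all_classical all_reals all_analysis.
From mathcomp Require Import measurable_realfun lra.

Set Implicit Arguments.
Unset Strict Implicit.
Unset Printing Implicit Defensive.
Import Order.TTheory GRing.Theory Num.Theory.
Import numFieldNormedType.Exports.

Local Open Scope classical_set_scope.
Local Open Scope ring_scope.

Definition measure_rV_display : measure_display -> measure_display.
Proof. exact. Qed.

(* The sigma-algebra on 'rV[T]_n is generated by the coordinates, as for
   n.-tuple T in the library; for T = R it is the Borel sigma-algebra. *)
Section measurable_rV.
Context {d} {T : measurableType d}.
Variable n : nat.

Let coors : 'I_n -> 'rV[T]_n -> T := fun i x => x ord0 i.

Let rV_set0 : g_sigma_preimage coors set0.
Proof. exact: sigma_algebra0. Qed.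

Let rV_setC A : g_sigma_preimage coors A -> g_sigma_preimage coors (~` A).
Proof. exact: sigma_algebraC. Qed.

Let rV_bigcup (F : _^nat) : (forall i, g_sigma_preimage coors (F i)) ->
  g_sigma_preimage coors (\bigcup_i (F i)).
Proof. exact: sigma_algebra_bigcup. Qed.

HB.instance Definition _ := @isMeasurable.Build (measure_rV_display d)
  'rV[T]_n (g_sigma_preimage coors) rV_set0 rV_setC rV_bigcup.

Lemma measurable_rV_coord (i : 'I_n) :
  measurable_fun [set: 'rV[T]_n] (fun x : 'rV[T]_n => x ord0 i).
Proof.
move=> _ Y mY; rewrite setTI; apply: sub_sigma_algebra => /=.
rewrite -bigcup_seq/=; exists i => /=; first by rewrite mem_index_enum.
by exists Y => //; rewrite setTI.
Qed.

Lemma measurable_fun_rV d1 (T1 : measurableType d1) (f : T1 -> 'rV[T]_n) :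
  (forall i, measurable_fun [set: T1] (fun t => f t ord0 i)) ->
  measurable_fun [set: T1] f.
Proof.
move=> mf.
pose G := \big[setU/set0]_(i < n) preimage_set_system setT (coors i) measurable.
apply: (@measurability _ _ _ _ setT f G) => //.
move=> _ [B GB <-].
move: GB; rewrite /G -bigcup_seq => -[i _ [Y mY <-]].
rewrite [X in _ `&` (_ @^-1` X)]setTI -comp_preimage.
exact: mf.
Qed.

End measurable_rV.

Section cons_rV.
Context {R : realType} {n : nat}.

Definition cons_rV (p : measurableTypeR R * 'rV[R]_n) : 'rV[R]_n.+1 :=
  \row_i oapp (p.2 ord0) p.1 (unlift ord0 i).

Definition uncons_rV (x : 'rV[R]_n.+1) : measurableTypeR R * 'rV[R]_n :=
  (x ord0 ord0, \row_i x ord0 (lift ord0 i)).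

Lemma cons_rVK : cancel cons_rV uncons_rV.
Proof.
move=> [t v]; rewrite /uncons_rV mxE unlift_none; congr pair.
by apply/rowP => i; rewrite !mxE liftK.
Qed.

Lemma uncons_rVK : cancel uncons_rV cons_rV.
Proof.
move=> x; apply/rowP => i; rewrite mxE.
by case: unliftP => [j|] -> //=; rewrite mxE.
Qed.

Lemma measurable_cons_rV : measurable_fun setT cons_rV.
Proof.
apply: measurable_fun_rV => i; under eq_fun do rewrite mxE.
case: (unlift ord0 i) => [j|] /=; last exact: measurable_fst.
exact: (measurableT_comp (measurable_rV_coord j) measurable_snd).
Qed.

Lemma measurable_uncons_rV : measurable_fun setT uncons_rV.
Proof.
apply/measurable_fun_pairP; split; first exact: measurable_rV_coord.
apply: measurable_fun_rV => i; under eq_fun do rewrite /= mxE.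
exact: measurable_rV_coord.
Qed.

End cons_rV.

Section lebesgue_rV.
Context {R : realType}.

Section step.
Local Open Scope ereal_scope.
Variables (n : nat) (m : {sigma_finite_measure set 'rV[R]_n -> \bar R}).

Definition lebesgue_rV_step : set 'rV[R]_n.+1 -> \bar R :=
  pushforward (@lebesgue_measure R \x m) cons_rV.

Let step0 : lebesgue_rV_step set0 = 0.
Proof. by rewrite /lebesgue_rV_step /pushforward preimage_set0 measure0. Qed.

Let step_ge0 A : 0 <= lebesgue_rV_step A.
Proof. by rewrite /lebesgue_rV_step /pushforward; exact: measure_ge0. Qed.

Let step_sigma_additive : semi_sigma_additive lebesgue_rV_step.
Proof.
have mc := @measurable_cons_rV R n.
move=> F mF tF mUF; rewrite /lebesgue_rV_step /pushforward preimage_bigcup.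
apply: measure_semi_sigma_additive.
- by move=> k; rewrite -[X in measurable X]setTI; exact: mc.
- apply/trivIsetP => /= i j _ _ ij; rewrite -preimage_setI.
  by move/trivIsetP : tF => /(_ _ _ _ _ ij) ->//; rewrite preimage_set0.
- by rewrite -preimage_bigcup -[X in measurable X]setTI; exact: mc.
Qed.

HB.instance Definition _ := isMeasure.Build _ _ _ lebesgue_rV_step
  step0 step_ge0 step_sigma_additive.

Let step_sigma_finite : sigma_finite setT lebesgue_rV_step.
Proof.
have [F TF Foo] : sigma_finite setT (@lebesgue_measure R \x m).
  have /sigma_finiteP[F [TF ndF Foo]] := sigma_finiteT (@lebesgue_measure R).
  have /sigma_finiteP[G [TG ndG Goo]] := sigma_finiteT m.
  exists (fun k => F k `*` G k).
    rewrite -setXTT TF TG predeqE => -[x y]; split.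
      move=> [/= [k _ Fkx] [l _ Gly]]; exists (maxn k l) => //; split.
      - by move: x Fkx; exact/subsetPset/ndF/leq_maxl.
      - by move: y Gly; exact/subsetPset/ndG/leq_maxr.
    by move=> [k _ []/= ? ?]; split; exists k.
  move=> k; have [? ?] := Foo k; have [? ?] := Goo k.
  split; first exact: measurableX.
  by rewrite product_measure1E// lte_mul_pinfty// ge0_fin_numE.
exists (fun k => @uncons_rV R n @^-1` F k).
  by rewrite -preimage_bigcup -TF.
move=> k; have [mF Fk] := Foo k; split.
  by rewrite -[X in measurable X]setTI; exact: measurable_uncons_rV.
rewrite /lebesgue_rV_step /pushforward -comp_preimage.
rewrite (_ : _ \o _ = id)//.
by apply/funext => p /=; rewrite cons_rVK.
Qed.

HB.instance Definition _ := Measure_isSigmaFinite.Build _ _ _ lebesgue_rV_step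
  step_sigma_finite.

End step.

(* Lebesgue measure on R^n: the iterated product of lebesgue_measure. *)
Fixpoint lebesgue_rV n : {sigma_finite_measure set 'rV[R]_n -> \bar R} :=
  match n with
  | 0 => dirac (0 : 'rV[R]_0)
  | n'.+1 => lebesgue_rV_step (lebesgue_rV n')
  end.

End lebesgue_rV.
Arguments lebesgue_rV R n : clear implicits.

Lemma measurable_box_rV (R : realType) n (A : 'I_n -> set R) :
  (forall i, measurable (A i)) ->
  measurable [set x : 'rV[R]_n | forall i, A i (x ord0 i)].
Proof.
move=> mA.
rewrite (_ : mkset _ =
    \bigcap_(i in setT) ((fun x : 'rV[R]_n => x ord0 i) @^-1` A i)).
  apply: fin_bigcap_measurable => // i _; rewrite -[X in measurable X]setTI.
  by apply: measurable_rV_coord.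
by apply/seteqP; split => x /= xA i; [move=> _; exact: xA|exact: (xA i I)].
Qed.

Lemma lebesgue_rV_box (R : realType) n (A : 'I_n -> set R) :
  (forall i, measurable (A i)) ->
  lebesgue_rV R n [set x | forall i, A i (x ord0 i)] =
  (\prod_(i < n) lebesgue_measure (A i))%E.
Proof.
elim: n A => [|n IH] A mA.
  by rewrite big_ord0 /= diracE mem_set//; case.
rewrite big_ord_recl -IH; last by move=> i; exact: mA.
rewrite -product_measure1E//; last 2 first.
- exact: mA.
- by apply: (@measurable_box_rV R n (fun i => A (lift ord0 i))) => i; exact: mA.
rewrite /= /lebesgue_rV_step /pushforward; congr product_measure1.
apply/seteqP; split => -[t v] /=.
  move=> tvA; split; first by have := tvA ord0; rewrite mxE unlift_none.
  by move=> i; have := tvA (lift ord0 i); rewrite mxE liftK.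
move=> [At vA] i; rewrite mxE.
by case: unliftP => [j|] -> //=; exact: vA.
Qed.

Lemma open_measurable_rV (R : realType) n (A : set 'rV[R]_n) :
  open A -> measurable A.
Proof.
move=> oA.
pose I (p : 'rV[rat]_n * rat) i : set R :=
  `]ratr (p.1 ord0 i) - ratr p.2, ratr (p.1 ord0 i) + ratr p.2[%classic.
pose box p : set 'rV[R]_n := [set x | forall i, I p i (x ord0 i)].
have mbox p : measurable (box p).
  by apply: (@measurable_box_rV R n (I p)) => i; exact: measurable_itv.
pose F k := if unpickle k is Some p then
  if `[< box p `<=` A >] then box p else set0 else set0.
rewrite (_ : A = \bigcup_k F k).
  apply: bigcupT_measurable => k; rewrite /F.
  by case: unpickle => // p; case: ifP.
apply/seteqP; split => [x Ax|x [k _]]; last first.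
  by rewrite /F; case: unpickle => // p; case: asboolP => // + xp; exact.
have /nbhs_ballP[e /= e0 eA] : nbhs x A by apply: open_nbhs_nbhs; split.
have [r] : exists r : rat, ratr r \in `]0, (e / 2)[.
  by apply: rat_in_itvoo; rewrite divr_gt0.
rewrite in_itv /= => /andP[r0 re].
have qP i : exists q : rat, ratr q \in `]x ord0 i - ratr r, x ord0 i + ratr r[.
  by apply: rat_in_itvoo; rewrite ltrBlDr -addrA ltrDl addr_gt0.
pose p := (\row_i xchoose (qP i), r).
have pP i : `|x ord0 i - ratr (p.1 ord0 i)| < ratr r.
  have := xchooseP (qP i); rewrite mxE in_itv /= => /andP[? ?].
  by rewrite ltr_norml; apply/andP; split; lra.
have pA : box p `<=` A.
  move=> y yp; apply: eA; split => // i j; rewrite (ord1 i) /ball /=.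
  have := yp j; have := pP j; rewrite /I /= in_itv /= => + /andP[].
  rewrite !ltr_norml => /andP[? ?] ? ?; apply/andP; split; lra.
exists (pickle p) => //; rewrite /F pickleK; case: asboolP => // _ i.
have := pP i; rewrite ltr_norml /I /= in_itv /= => /andP[? ?].
by apply/andP; split; lra.
Qed.

Lemma continuous_measurable_rV (R : realType) n (f : 'rV[R]_n -> R) :
  continuous f -> measurable_fun setT f.
Proof.
move=> /continuousP cf; apply: (measurability _ (RGenOpens.measurableE R)).
move=> _ [_ [a [b ->] <-]]; rewrite setTI; apply: open_measurable_rV.
exact/cf/interval_open.
Qed.

Section calculus.
Context {R : realType} {d : nat}.
Implicit Types (f g U sigma : 'rV[R]_d -> R) (F : 'rV[R]_d -> 'rV[R]_d).

Definition inner (u v : 'rV[R]_d) : R := \sum_(i < d) u ord0 i * v ord0 i.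

Definition enorm (u : 'rV[R]_d) : R := Num.sqrt (inner u u).

(* A v for a column vector v, with vectors stored as rows *)
Definition mxact (A : 'M[R]_d) (v : 'rV[R]_d) : 'rV[R]_d := v *m A^T.

Definition frobenius (A : 'M[R]_d) : R := Num.sqrt (\tr (A^T *m A)).

Definition partial (i : 'I_d) f : 'rV[R]_d -> R :=
  fun x => 'D_(delta_mx ord0 i) f x.

Definition grad f : 'rV[R]_d -> 'rV[R]_d := fun x => \row_i partial i f x.

Definition hessian f : 'rV[R]_d -> 'M[R]_d :=
  fun x => \matrix_(i, j) partial i (partial j f) x.

Definition div F : 'rV[R]_d -> R :=
  fun x => \sum_(i < d) partial i (fun y => F y ord0 i) x.

Definition laplacian f : 'rV[R]_d -> R := div (grad f).

Fixpoint Ck (k : nat) f : Prop :=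
  match k with
  | 0 => continuous f
  | k'.+1 => (forall x, differentiable f x) /\ forall i, Ck k' (partial i f)
  end.

Definition smooth f : Prop := forall k, Ck k f.

Lemma smooth_continuous f : smooth f -> continuous f.
Proof. by move=> /(_ 0%N). Qed.

Definition compactly_supported f : Prop :=
  compact (closure [set x | f x != 0]).

Definition nabla_star U F : 'rV[R]_d -> R :=
  fun x => - div F x + inner (grad U x) (F x).

Definition L_sigma U sigma g : 'rV[R]_d -> R :=
  fun x => - nabla_star U (fun y => sigma y ^+ 2 *: grad g y) x.

Definition L_0 U g : 'rV[R]_d -> R := fun x => - nabla_star U (grad g) x.

Definition Theta U sigma g : 'rV[R]_d -> R := fun x =>
  4 * sigma x ^+ 3 * inner (grad sigma x) (mxact (hessian g x) (grad g x))
  + 3 * sigma x ^+ 2 * enorm (grad sigma x) ^+ 2 * enorm (grad g x) ^+ 2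
  - sigma x ^+ 3 * enorm (grad g x) ^+ 2 * inner (grad sigma x) (grad U x)
  + sigma x ^+ 3 * enorm (grad g x) ^+ 2 * laplacian sigma x
  - 2 * sigma x ^+ 3 * inner (grad g x) (grad sigma x) * L_0 U g x
  - 2 * sigma x ^+ 2 * inner (grad g x) (grad sigma x) ^+ 2
  - 2 * sigma x ^+ 3 *
    inner (grad g x) (mxact (hessian sigma x) (grad g x)).

End calculus.

Section gibbs.
Context {R : realType} {d : nat}.
Local Open Scope ereal_scope.

Definition partition_function (U : 'rV[R]_d -> R) : \bar R :=
  \int[lebesgue_rV R d]_x (expR (- U x))%:E.

(* The measure Z_U^-1 e^(-U(x)) dx. Continuity of U is only used to make it an
   instance of measure; it is meaningful when 0 < Z_U < +oo. *)
Definition gibbs (U : 'rV[R]_d -> R) of continuous U : set 'rV[R]_d -> \bar R :=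
  fun A => ((fine (partition_function U))^-1)%:E *
    \int[lebesgue_rV R d]_(x in A) (expR (- U x))%:E.

Variables (U : 'rV[R]_d -> R) (cU : continuous U).

Let gibbs0 : gibbs cU set0 = 0.
Proof. by rewrite /gibbs integral_set0 mule0. Qed.

Let gibbs_ge0 A : 0 <= gibbs cU A.
Proof.
rewrite /gibbs mule_ge0//.
  rewrite lee_fin invr_ge0 fine_ge0//; apply: integral_ge0 => x _.
  by rewrite lee_fin expR_ge0.
by apply: integral_ge0 => x _; rewrite lee_fin expR_ge0.
Qed.

Let gibbs_sigma_additive : semi_sigma_additive (gibbs cU).
Proof.
move=> F mF tF mUF; rewrite /gibbs.
pose nu A := \int[lebesgue_rV R d]_(x in A) (expR (- U x))%:E.
rewrite [X in X @ \oo --> _](_ : _ = (fun n =>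
    ((fine (partition_function U))^-1)%:E * \sum_(0 <= i < n) nu (F i))).
  apply: cvgeZl => //; apply: semi_sigma_additive_nng_induced => //.
  apply/measurable_EFinP; apply: measurableT_comp => //.
  by apply: measurableT_comp => //; exact: continuous_measurable_rV.
apply/funext => n; rewrite ge0_sume_distrr// => i _.
by apply: integral_ge0 => x _; rewrite lee_fin expR_ge0.
Qed.

HB.instance Definition _ := isMeasure.Build _ _ _ (gibbs cU)
  gibbs0 gibbs_ge0 gibbs_sigma_additive.

End gibbs.

(* Main.v *)
Require Import Defs.
From mathcomp Require Import all_boot all_order all_algebra.
From mathcomp Require Import all_classical all_reals all_analysis.
From mathcomp Require Import measurable_realfun ring lra.
Set Implicit Arguments.
Unset Strict Implicit.
Unset Printing Implicit Defensive.
Import Order.TTheory GRing.Theory Num.Theory.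
Import numFieldNormedType.Exports.
Local Open Scope classical_set_scope.
Local Open Scope ring_scope.

(** Write [a] for the gradient of [g], [s] for that of [sigma], [H] for the
    Hessian of [g] and [L] for [L_0 g]. The difference between
    [(L_sigma g)^2] and the sum of the three integrands of the claim is minus
    the [nabla_star] of the compactly supported C^1 field
      sigma^4 L a - sigma^4 H a - sigma^3 |a|^2 s + 2 sigma^3 <a, s> a.
    Pointwise, this is the Leibniz rule for [nabla_star] together with the
    Bochner identity
      nabla_star (H a) = - <grad L, a> - |H|^2 - <a, Hess U a>.
    The [mu]-integral of such a [nabla_star F] vanishes, because
    [exp(-U) nabla_star F = - div (exp(-U) F)], and each partial derivative of
    a compactly supported C^1 function integrates to zero by Fubini and the
    fundamental theorem of calculus. *)

(** * Functions of class C^k and symmetry of second derivatives *)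

Section Ck_theory.
Context {R : realType} {d : nat}.
Implicit Types (f g : 'rV[R]_d -> R).

Lemma eq_partial f g i x : f =1 g -> partial i f x = partial i g x.
Proof. by move=> /funext ->. Qed.

Lemma partialD f g i x : differentiable f x -> differentiable g x ->
  partial i (fun y => f y + g y) x = partial i f x + partial i g x.
Proof. by move=> df dg; rewrite /partial -deriveD//; exact: diff_derivable. Qed.

Lemma partialB f g i x : differentiable f x -> differentiable g x ->
  partial i (fun y => f y - g y) x = partial i f x - partial i g x.
Proof. by move=> df dg; rewrite /partial -deriveB//; exact: diff_derivable. Qed.

Lemma partialM f g i x : differentiable f x -> differentiable g x ->
  partial i (fun y => f y * g y) x = f x * partial i g x + g x * partial i f x.
Proof.
by move=> df dg; rewrite /partial -[RHS]deriveM//; exact: diff_derivable.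
Qed.

Lemma partial_cst (c : R) i x : partial i (fun=> c : R) (x : 'rV[R]_d) = 0.
Proof. exact: derive_cst. Qed.

Lemma partial_sum n (f : 'I_n -> 'rV[R]_d -> R) i x :
  (forall j, differentiable (f j) x) ->
  partial i (fun y => \sum_(j < n) f j y) x = \sum_(j < n) partial i (f j) x.
Proof.
move=> df; rewrite /partial -derive_sum; last by move=> j; exact: diff_derivable.
by congr ('D_ _ _ x); apply/funext => y; rewrite fct_sumE.
Qed.

Lemma CkS k f : Ck k.+1 f -> Ck k f.
Proof.
elim: k f => [|k IH] f [df Cf]; first by move=> x; exact/differentiable_continuous.
by split => // i; exact: IH.
Qed.

Lemma Ck_partial k f i : Ck k.+1 f -> Ck k (partial i f).
Proof. by case=> _; exact. Qed.

Lemma Ck_differentiable k f x : Ck k.+1 f -> differentiable f x.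
Proof. by case=> + _; exact. Qed.

Lemma Ck_cst k (c : R) : Ck k ((fun=> c) : 'rV[R]_d -> R).
Proof.
elim: k c => [|k IH] c; first exact: cst_continuous.
split=> [x|i]; first exact: differentiable_cst.
by rewrite (_ : partial i _ = fun=> 0)//; apply/funext => x; exact: partial_cst.
Qed.

Lemma CkD k f g : Ck k f -> Ck k g -> Ck k (fun x => f x + g x).
Proof.
elim: k f g => [|k IH] f g; first by move=> cf cg x; exact: (continuousD (cf x) (cg x)).
move=> [df Cf] [dg Cg]; split=> [x|i]; first exact: differentiableD.
rewrite (_ : partial i _ = fun x => partial i f x + partial i g x).
  by apply: IH; [exact: Cf|exact: Cg].
by apply/funext => x; rewrite partialD.
Qed.

Lemma CkM k f g : Ck k f -> Ck k g -> Ck k (fun x => f x * g x).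
Proof.
elim: k f g => [|k IH] f g; first by move=> cf cg x; exact: (continuousM (cf x) (cg x)).
move=> Cf Cg; split=> [x|i].
  exact: differentiableM (Ck_differentiable x Cf) (Ck_differentiable x Cg).
rewrite (_ : partial i _ = fun x => f x * partial i g x + g x * partial i f x).
  by have ? := CkS Cf; have ? := CkS Cg; apply: CkD; apply: IH => //; exact: Ck_partial.
apply/funext => x.
exact: (partialM _ (Ck_differentiable x Cf) (Ck_differentiable x Cg)).
Qed.

Lemma CkN k f : Ck k f -> Ck k (fun x => - f x).
Proof.
move=> Cf; rewrite (_ : (fun x => _) = fun x => -1 * f x).
  by apply: CkM => //; exact: Ck_cst.
by apply/funext => x; rewrite mulN1r.
Qed.

Lemma CkX k f n : Ck k f -> Ck k (fun x => f x ^+ n).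
Proof.
move=> Cf; elim: n => [|n IH]; first exact: Ck_cst.
rewrite (_ : (fun x => _) = fun x => f x * f x ^+ n); first exact: CkM.
by apply/funext => x; rewrite exprS.
Qed.

Lemma Ck_sum k n (f : 'I_n -> 'rV[R]_d -> R) : (forall j, Ck k (f j)) ->
  Ck k (fun x => \sum_(j < n) f j x).
Proof.
elim: n f => [|n IH] f Cf.
  rewrite (_ : (fun x => _) = fun=> 0); first exact: Ck_cst.
  by apply/funext => x; rewrite big_ord0.
rewrite (_ : (fun x => _) = fun x => f ord0 x + \sum_(j < n) f (lift ord0 j) x).
  by apply: CkD => //; exact: (IH (fun j => f (lift ord0 j))).
by apply/funext => x; rewrite big_ord_recl.
Qed.

Lemma partialX f n i x : differentiable f x ->
  partial i (fun y => f y ^+ n) x = n%:R * f x ^+ n.-1 * partial i f x.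
Proof.
(* [EX] turns the pointwise power into the power in the ring of functions, the form that [deriveX]
   differentiates. *)
move=> df; have EX m : (fun y => f y ^+ m) = f ^+ m.
  elim: m => [|m IH]; apply/funext => y; first by rewrite !expr0.
  by rewrite !exprS -IH.
rewrite /partial EX deriveX; last exact: diff_derivable.
by [].
Qed.

Lemma partialN f i x : differentiable f x ->
  partial i (fun y => - f y) x = - partial i f x.
Proof. by move=> df; rewrite /partial -deriveN//; exact: diff_derivable. Qed.

Lemma differentiable_expR f x : differentiable f x ->
  differentiable (fun y => expR (f y)) x.
Proof.
move=> df; apply: (@differentiable_comp _ _ _ _ f expR) => //.
exact/derivable1_diffP.
Qed.

Lemma partial_expR f i x : differentiable f x ->
  partial i (fun y => expR (f y)) x = expR (f x) * partial i f x.
Proof.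
move=> df; have dE : differentiable expR (f x) by exact/derivable1_diffP.
rewrite /partial deriveE; last exact: differentiable_expR.
rewrite (@diff_comp _ _ _ _ f expR)//= deriveE//.
by rewrite deriv1E// derive1E derive_val [LHS]mulrC.
Qed.

Lemma Ck_expR k f : Ck k f -> Ck k (fun x => expR (f x)).
Proof.
elim: k f => [|k IH] f Cf.
  by move=> x; apply: continuous_comp; [exact: Cf|exact: continuous_expR].
split=> [x|i]; first exact/differentiable_expR/(Ck_differentiable x Cf).
rewrite (_ : partial i _ = fun x => expR (f x) * partial i f x).
  by apply: CkM; [apply/IH/CkS|exact: Ck_partial].
by apply/funext => x; rewrite partial_expR//; exact: Ck_differentiable Cf.
Qed.

(** The difference quotients of the restriction to a line are literally those of [f] along [v]. This
    opens directional derivatives to one-variable theorems. *)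
Lemma is_derive_line f (x v : 'rV[R]_d) (t : R) : derivable f (x + t *: v) v ->
  is_derive t 1 (fun t => f (x + t *: v)) ('D_v f (x + t *: v)).
Proof.
move=> df; pose F (t : R) := f (x + t *: v).
have E : (fun h : R => h^-1 *: ((F \o shift t) (h *: 1) - F t)) =
    (fun h => h^-1 *: ((f \o shift (x + t *: v)) (h *: v) - f (x + t *: v))).
  apply/funext => h /=; rewrite /F [h *: 1]mulr1; congr (_ *: (f _ - _)).
  by rewrite scalerDl addrCA.
split; last by rewrite /derive -E.
by move: df; rewrite /derivable -E.
Qed.

Lemma MVT_line f (x v : 'rV[R]_d) (h : R) : 0 < h ->
  (forall y, derivable f y v) ->
  exists2 c, 0 < c < h & f (x + h *: v) - f x = h * 'D_v f (x + c *: v).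
Proof.
move=> h0 df.
have dF (t : R) := is_derive_line (df (x + t *: v)).
have [|c + E] := @MVT _ (fun t => f (x + t *: v)) (fun t => 'D_v f (x + t *: v)) 0 h h0.
  apply: continuous_subspaceT => t.
  by apply/differentiable_continuous/derivable1_diffP; case: (dF t).
rewrite in_itv/= => ch; exists c => //.
by move: E; rewrite scale0r addr0 subr0 mulrC.
Qed.

Lemma is_derive_translate f (x v w : 'rV[R]_d) : derivable f (x + w) v ->
  is_derive x v (fun y => f (y + w)) ('D_v f (x + w)).
Proof.
have E : (fun h : R => h^-1 *: (((fun y => f (y + w)) \o shift x) (h *: v) - f (x + w))) =
    (fun h => h^-1 *: ((f \o shift (x + w)) (h *: v) - f (x + w))).
  by apply/funext => h /=; rewrite addrA.
by move=> df; split; [move: df; rewrite /derivable -E|rewrite /derive -E].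
Qed.

Lemma second_difference f i j x (h : R) : Ck 2 f -> 0 < h ->
  exists2 y, `|y - x| < 2 * h &
  f (x + h *: delta_mx ord0 i + h *: delta_mx ord0 j) - f (x + h *: delta_mx ord0 i)
  - f (x + h *: delta_mx ord0 j) + f x = h ^+ 2 * partial j (partial i f) y.
Proof.
move=> Cf h0; set ei := delta_mx ord0 i; set ej := delta_mx ord0 j.
have df y : differentiable f y by exact: Ck_differentiable Cf.
pose G y := f (y + h *: ej) - f y.
have dsh y := is_derive_translate (@diff_derivable _ _ _ _ _ ei (df (y + h *: ej))).
have dG y : derivable G y ei.
  by apply: derivableB; [case: (dsh y)|exact: diff_derivable].
have DG y : 'D_ei G y = partial i f (y + h *: ej) - partial i f y.
  by rewrite /G deriveB; [case: (dsh y) => _ ->|case: (dsh y)|exact: diff_derivable].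
have [c /andP[c0 ch] Ec] := MVT_line x h0 dG.
have [|c' /andP[c'0 c'h] Ec'] := @MVT_line (partial i f) (x + c *: ei) ej h h0.
  by move=> y; apply: diff_derivable; exact/Ck_differentiable/Ck_partial/Cf.
exists (x + c *: ei + c' *: ej).
  (* Basis vectors have max norm at most 1, so [y] lies within [c + c' < 2 h] of [x]. *)
  have e1 k : `|delta_mx ord0 k : 'rV[R]_d| <= 1.
    rewrite [leLHS]/Num.norm /= mx_normrE; apply/bigmax_leP; split => // -[a b] _ /=.
    by rewrite mxE; case: (_ && _); rewrite ?normr1 ?normr0.
  rewrite -(addrA x) [_ - x]addrC addKr (le_lt_trans (ler_normD _ _))// !normrZ.
  rewrite !gtr0_norm// (@le_lt_trans _ _ (c + c'))//; last lra.
  by rewrite lerD// ler_piMr// ?e1// ltW.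
move: Ec; rewrite DG Ec' /G => Ec.
by rewrite expr2 -mulrA -Ec (addrAC x); ring.
Qed.

(** By contradiction: take [e] half of the gap [|A x - B x|]. Close to [x], [A y] and [B z] are
    within [e] of [A x] and [B x], so [A y = B z] would make the gap less than [2 e]. *)
Lemma continuous_eq_limit (A B : 'rV[R]_d -> R) (x : 'rV[R]_d) :
  {for x, continuous A} -> {for x, continuous B} ->
  (forall h, 0 < h -> exists y z,
    [/\ `|y - x| < 2 * h, `|z - x| < 2 * h & A y = B z]) ->
  A x = B x.
Proof.
move=> cA cB AB; apply/eqP/negP => /negP ne.
pose e := `|A x - B x| / 2.
have e0 : 0 < e by rewrite divr_gt0// normr_gt0 subr_eq0.
have /cvgrPdist_lt/(_ e e0)/nbhs_normP[r1 /= r10 H1] := cA.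
have /cvgrPdist_lt/(_ e e0)/nbhs_normP[r2 /= r20 H2] := cB.
pose h := Num.min r1 r2 / 2.
have h0 : 0 < h by rewrite divr_gt0// lt_min r10.
have [hr1 hr2] : 2 * h <= r1 /\ 2 * h <= r2.
  by rewrite /h mulrC divfK// !ge_min !lexx orbT.
have [y [z [yx zx yz]]] := AB h h0.
have := H1 y; rewrite /= distrC => /(_ (lt_le_trans yx hr1)) A1.
have := H2 z; rewrite /= distrC => /(_ (lt_le_trans zx hr2)); rewrite -yz => B1.
have := ler_distD (A y) (A x) (B x).
have : `|A x - B x| = e + e by rewrite /e; field.
by rewrite (distrC (A y) (B x)); lra.
Qed.

(** Schwarz's theorem. The second difference is symmetric in [i] and [j], so for every [h > 0] the
    two mixed partials share a value at points within [2 h] of [x]; their continuity concludes. *)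
Lemma partialC f i j : Ck 2 f -> partial i (partial j f) = partial j (partial i f).
Proof.
move=> Cf; apply/funext => x; apply: continuous_eq_limit.
- exact: (Ck_partial i (Ck_partial j Cf)).
- exact: (Ck_partial j (Ck_partial i Cf)).
move=> h h0; have [y1 y1x E1] := second_difference i j x Cf h0.
have [y2 y2x E2] := second_difference j i x Cf h0.
exists y2, y1; split; [exact: y2x|exact: y1x|].
have h2 : h ^+ 2 != 0 by rewrite expf_neq0// gt_eqF.
apply: (mulfI h2); rewrite -E1 -E2 (addrAC x); congr (_ + _); exact: addrAC.
Qed.

End Ck_theory.

(** * Integrals of partial derivatives *)

Section integration_rV.
Context {R : realType}.

Lemma coord_le_norm n (x : 'rV[R]_n) i : `|x ord0 i| <= `|x|.
Proof.
rewrite [leRHS]/Num.norm /= mx_normrE; apply/bigmax_geP; right => /=.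
by exists (ord0, i).
Qed.

(** [|f|] attains a maximum on a compact ball outside of which [f] vanishes. The radius [|M| + 1] is
    positive whatever the sign of [M]. *)
Lemma bounded_supp_bounded n (M : R) (f : 'rV[R]_n -> R) : continuous f ->
  (forall x, M < `|x| -> f x = 0) -> exists2 C, 0 <= C & forall x, `|f x| <= C.
Proof.
move=> cf f0.
have cK : compact (closed_ball (0 : 'rV[R]_n) (`|M| + 1)).
  apply: bounded_closed_compact; last exact: closed_ball_closed.
  exists (`|M| + 1); split => // r Mr x; rewrite closed_ballE ?ltr_wpDl//.
  by rewrite /closed_ball_/= sub0r normrN => /le_trans; apply; exact: ltW.
have [|||x0 _ hx0] := @compact_EVT_max _ R (fun x => `|f x|)
  (closed_ball (0 : 'rV[R]_n) (`|M| + 1)).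
- by exists 0; apply: closed_ballxx; rewrite ltr_wpDl.
- exact: cK.
- apply: continuous_subspaceT => x.
  by apply: continuous_comp; [exact: cf|exact: norm_continuous].
exists `|f x0| => // x.
have [Mx|Mx] := ltP M `|x|; first by rewrite f0// normr0.
apply: hx0; rewrite inE closed_ballE ?ltr_wpDl// /closed_ball_/= sub0r normrN.
by rewrite (le_trans Mx)// (le_trans (ler_norm M))// lerDl.
Qed.

Lemma lebesgue_rV_cube_lty n (r : R) :
  (lebesgue_rV R n [set x : 'rV[R]_n | forall i, `[(- r)%R, r]%classic (x ord0 i)]
   < +oo)%E.
Proof.
rewrite (@lebesgue_rV_box R n (fun=> `[- r, r]%classic))//.
suff : (\prod_(i < n) lebesgue_measure `[(- r)%R, r]%classic)%E \is a fin_num.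
  by rewrite fin_numE => /andP[_ ?]; rewrite lt_neqAle leey andbT.
elim/big_ind : _ => // [x y|i _]; first exact: fin_numM.
by rewrite lebesgue_measure_itv/=; case: ifP.
Qed.

(** Balls of the max norm are cubes: [f] is bounded and vanishes outside the cube [K], whose measure
    is finite. *)
Lemma integrable_bounded_supp n (M : R) (f : 'rV[R]_n -> R) : continuous f ->
  (forall x, M < `|x| -> f x = 0) ->
  (lebesgue_rV R n).-integrable setT (EFin \o f).
Proof.
move=> cf f0.
pose K : set 'rV[R]_n := [set x | forall i, `[- M, M]%classic (x ord0 i)].
have mK : measurable K.
  by apply: (@measurable_box_rV R n (fun=> `[- M, M]%classic)).
have [C C0 fC] := bounded_supp_bounded cf f0.
have mf := continuous_measurable_rV cf.
have : (lebesgue_rV R n).-integrable K (EFin \o f).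
  apply: measurable_bounded_integrable => //.
  - exact: lebesgue_rV_cube_lty.
  - exact: measurable_funTS.
  - exists C; split; first exact: ger0_real.
    by move=> r Cr x _; apply: le_trans (ltW Cr); exact: fC.
rewrite (@integrable_mkcond _ _ _ _ _ _ mK); congr (_.-integrable _ _).
apply/funext => x; rewrite patchE; case: ifPn => // /negP xK /=.
rewrite f0//; rewrite ltNge; apply/negP => xM; apply: xK; rewrite inE => i /=.
by rewrite in_itv/= -ler_norml (le_trans (coord_le_norm _ _)).
Qed.

End integration_rV.

(** * Integration against a measure with a density *)

Section density.
Context d (T : measurableType d) (R : realType).
Variables (m nu : {measure set T -> \bar R}) (w : T -> R).
Hypotheses (w0 : forall x, 0 <= w x) (mw : measurable_fun setT w).
Hypothesis nuE : forall A, measurable A -> nu A = (\int[m]_(x in A) (w x)%:E)%E.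
Local Open Scope ereal_scope.

Import HBNNSimple.

(** Monotone convergence along simple functions increasing to [f], used for both measures. Since [w]
    is nonnegative, the products with [w] increase as well, and only simple functions remain to be
    compared. *)
Lemma ge0_integral_density (f : T -> \bar R) : measurable_fun setT f ->
  (forall x, 0 <= f x) ->
  \int[nu]_x f x = \int[m]_x (f x * (w x)%:E).
Proof.
move=> mf f0; have mw' : measurable_fun setT (EFin \o w) by exact/measurable_EFinP.
pose h := nnsfun_approx measurableT mf.
transitivity (lim (\int[nu]_x (h n x)%:E @[n --> \oo])).
  rewrite -monotone_convergence//.
  - by apply: eq_integral => x _; apply/esym/cvg_lim => //; exact: cvg_nnsfun_approx.
  - by move=> n; exact/measurable_EFinP.
  - by move=> n x _; rewrite lee_fin.
  - by move=> x _ a b ab; rewrite lee_fin; exact/lefP/nd_nnsfun_approx.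
transitivity (lim (\int[m]_x ((h n x)%:E * (w x)%:E) @[n --> \oo])); last first.
  rewrite -monotone_convergence//.
  - apply: eq_integral => x _; apply/cvg_lim => //.
    by apply: cvgeZr => //; exact: cvg_nnsfun_approx.
  - by move=> n; apply: emeasurable_funM => //; exact/measurable_EFinP.
  - by move=> n x _; rewrite mule_ge0// lee_fin.
  - move=> x _ a b ab; rewrite lee_wpmul2r// ?lee_fin//.
    exact/lefP/nd_nnsfun_approx.
apply: congr_lim; apply/funext => n; rewrite [LHS]integralT_nnsfun sintegralE.
under [in RHS]eq_integral => x _.
  rewrite fimfunE -fsumEFin// ge0_mule_fsuml; last first.
    by move=> r; rewrite EFinM nnfun_muleindic_ge0.
  over.
rewrite ge0_integral_fsum//; last 2 first.
- by move=> r; apply: emeasurable_funM => //; exact/measurable_EFinP/measurableT_comp.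
- move=> r x _; apply: mule_ge0; last by rewrite lee_fin.
  by rewrite EFinM nnfun_muleindic_ge0.
(* One value [r] of the simple function at a time: the [nu]-measure of its level set is the integral
   of [w] over that set. *)
apply: eq_fsbigr => r /[!inE] -[x _ <-].
rewrite nuE// (integral_mkcond (h n @^-1` _)) -ge0_integralZl//; last 3 first.
- by apply/(measurable_restrictT _ _).1 => //; exact: measurable_funTS.
- by move=> y _; rewrite erestrict_ge0// => z _; rewrite lee_fin.
- by rewrite lee_fin.
apply: eq_integral => y _; rewrite patchE indicE.
by case: ifPn => /= _; rewrite ?mulr1 ?mulr0 ?mule0 ?mul0e.
Qed.

(** Multiplication by [w >= 0] commutes with taking positive and negative parts, to which the
    nonnegative case applies. *)
Lemma integral_density (f : T -> R) : measurable_fun setT f ->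
  \int[nu]_x (f x)%:E = \int[m]_x (f x * w x)%:E.
Proof.
move=> mf; have mf' : measurable_fun setT (EFin \o f) by exact/measurable_EFinP.
rewrite [LHS]integralE [RHS]integralE !ge0_integral_density//.
- congr (_ - _); apply: eq_integral => x _; rewrite ?funeposE ?funenegE.
    by rewrite muleC maxe_pMr// ?lee_fin// mule0 muleC.
  by rewrite muleC maxe_pMr// ?lee_fin// mule0 muleC -EFinN -!EFinM mulNr.
- exact: measurable_funeneg.
- exact: measurable_funepos.
Qed.

End density.

(** * Slices of functions on R^(n+1) *)

Section fubini_partial.
Context {R : realType}.

Lemma near_norm_gt (V : normedModType R) (M : R) (x : V) :
  M < `|x| -> \forall y \near x, M < `|y|.
Proof.
move=> Mx; apply/nbhs_normP; exists (`|x| - M); first by rewrite /= subr_gt0.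
move=> y /= xy; have := ler_normD (x - y) y; rewrite subrK; lra.
Qed.

Lemma continuous_cons_rVl n (v : 'rV[R]_n) :
  continuous (fun t : R => cons_rV (t, v) : 'rV[R]_n.+1).
Proof.
move=> t; apply/cvg_ballP => e e0; apply: filterS (nbhsx_ballx t e e0) => s ts.
split => // i j; rewrite (ord1 i) !mxE.
by case: unliftP => [k|] _ //=; exact: ballxx.
Qed.

Lemma continuous_cons_rVr n (t : R) :
  continuous (fun v : 'rV[R]_n => cons_rV (t, v) : 'rV[R]_n.+1).
Proof.
move=> v; have FF := nbhs_filter v; apply/cvg_ballP => e e0.
apply: filterS (nbhsx_ballx v e e0) => s [_ vs].
split => // i j; rewrite (ord1 i) !mxE.
by case: unliftP => [k|] _ /=; [exact: vs|exact: ballxx].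
Qed.

(** Together with [cons_rV_shiftS], this matches the difference quotients of the slices of a
    function with those of the function itself. *)
Lemma cons_rV_shift0 n (h t : R) (v : 'rV[R]_n) :
  cons_rV (h + t, v) = h *: delta_mx ord0 ord0 + cons_rV (t, v).
Proof.
apply/rowP => i; rewrite !mxE eqxx/=.
by case: unliftP => [j|] -> /=; rewrite ?eqxx ?mulr1// mulr0 add0r.
Qed.

Lemma cons_rV_shiftS n (h t : R) (v : 'rV[R]_n) i :
  cons_rV (t, h *: delta_mx ord0 i + v) =
  h *: delta_mx ord0 (lift ord0 i) + cons_rV (t, v).
Proof.
apply/rowP => k; rewrite !mxE eqxx/=.
case: unliftP => [j|] -> /=; rewrite ?mulr0 ?add0r// !mxE eqxx/=.
by rewrite (inj_eq (@lift_inj _ ord0)).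
Qed.

Lemma cons_rV_norml n (t : R) (v : 'rV[R]_n) : `|t| <= `|cons_rV (t, v)|.
Proof.
by have := coord_le_norm (cons_rV (t, v)) ord0; rewrite mxE unlift_none.
Qed.

Lemma cons_rV_normr n (t : R) (v : 'rV[R]_n) : `|v| <= `|cons_rV (t, v)|.
Proof.
rewrite [leLHS]/Num.norm /= mx_normrE; apply/bigmax_leP; split => // -[i j] _ /=.
have := coord_le_norm (cons_rV (t, v)) (lift ord0 j).
by rewrite mxE liftK /= (ord1 i).
Qed.

(** The fundamental theorem of calculus on [[-a, a]] with [f] zero at both ends. Beyond [M], [f] is
    locally zero and hence so is [f'], so nothing is lost by restricting to this interval. *)
Lemma integral_derive_compact_supp (f f' : R -> R) (M : R) :
  (forall t : R, is_derive t 1 f (f' t)) -> continuous f' ->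
  (forall t : R, M < `|t| -> f t = 0) ->
  (\int[lebesgue_measure]_t (f' t)%:E = 0)%E.
Proof.
move=> df cf' f0.
have df1 t : derivable f t 1 by case: (df t).
have f'0 t : M < `|t| -> f' t = 0.
  move=> Mt; case: (df t) => _ <-.
  rewrite (near_eq_derive _ (_ : \near t, f t = cst 0 t)) ?derive_cst//.
  by apply: filterS (near_norm_gt Mt) => s; exact: f0.
(* This [a] exceeds [M] and is positive even if [M] is not. *)
pose a := `|M| + 1; have a0 : 0 < a by rewrite ltr_wpDl.
have Ma : M < a by rewrite (le_lt_trans (ler_norm M))// ltrDl.
have cf : continuous f.
  by move=> t; apply/differentiable_continuous/derivable1_diffP.
transitivity (\int[lebesgue_measure]_(t in `[(- a)%R, a]) (f' t)%:E)%E.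
  rewrite [RHS]integral_mkcond; apply: eq_integral => t _; rewrite patchE.
  case: ifPn => // /negP ta; rewrite f'0// (lt_trans Ma)// ltNge ler_norml.
  by apply/negP => ta'; apply: ta; rewrite inE /= in_itv.
rewrite (@continuous_FTC2 _ f' f)//.
- by rewrite !f0 ?subee// ?normrN gtr0_norm.
- by rewrite (lt_trans _ a0)// oppr_lt0.
- exact: continuous_subspaceT.
- split.
  + by move=> t _; exact: df1.
  + exact/cvg_at_right_filter/cf.
  + exact/cvg_at_left_filter/cf.
- by move=> t _; rewrite derive1E derive_val.
Qed.

End fubini_partial.

(** * Vanishing of the integral of a partial derivative *)

Section gauss.
Context {R : realType}.

(** [lebesgue_rV R n.+1] is the pushforward of a product measure under [cons_rV]. Fubini's theorem
    asks for integrability on the product side. *)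
Lemma integrable_cons_rV n (f : 'rV[R]_n.+1 -> R) :
  measurable_fun setT f ->
  (lebesgue_rV R n.+1).-integrable setT (EFin \o f) ->
  (@lebesgue_measure R \x lebesgue_rV R n)%E.-integrable setT
    (EFin \o f \o cons_rV).
Proof.
move=> mf /integrableP[_ foo]; apply/integrableP; split.
  by apply/measurable_EFinP; apply: measurableT_comp => //; exact: measurable_cons_rV.
move: foo; rewrite ge0_integral_pushforward//; first exact: measurable_cons_rV.
by do 2 apply: measurableT_comp => //.
Qed.

Lemma is_derive_cons_rV0 n (f : 'rV[R]_n.+1 -> R) (v : 'rV[R]_n) (t : R) :
  (forall x, derivable f x (delta_mx ord0 ord0)) ->
  is_derive t 1 (fun t => f (cons_rV (t, v))) (partial ord0 f (cons_rV (t, v))).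
Proof.
move=> df; pose F t := f (cons_rV (t, v)).
have E : (fun h : R => h^-1 *: ((F \o shift t) (h *: 1) - F t)) =
    (fun h => h^-1 *: ((f \o shift (cons_rV (t, v))) (h *: delta_mx ord0 ord0)
      - f (cons_rV (t, v)))).
  by apply/funext => h /=; rewrite -cons_rV_shift0 /F [h *: 1]mulr1.
split; last by rewrite /partial /derive -E.
by have := df (cons_rV (t, v)); rewrite /derivable -E.
Qed.

(** Equality of the quotients before any limit yields both the derivability of a slice and the value
    of its partial derivative. *)
Lemma growth_rate_cons_rVS n (f : 'rV[R]_n.+1 -> R) (t : R) (v : 'rV[R]_n) i :
  (fun h : R => h^-1 *: (((fun v => f (cons_rV (t, v))) \o shift v)
     (h *: delta_mx ord0 i) - f (cons_rV (t, v)))) =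
  (fun h => h^-1 *: ((f \o shift (cons_rV (t, v)))
     (h *: delta_mx ord0 (lift ord0 i)) - f (cons_rV (t, v)))).
Proof. by apply/funext => h /=; rewrite cons_rV_shiftS. Qed.

Lemma derivable_cons_rVS n (f : 'rV[R]_n.+1 -> R) (t : R) (v : 'rV[R]_n) i :
  derivable f (cons_rV (t, v)) (delta_mx ord0 (lift ord0 i)) ->
  derivable (fun v => f (cons_rV (t, v))) v (delta_mx ord0 i).
Proof. by rewrite /derivable growth_rate_cons_rVS. Qed.

Lemma partial_cons_rVS n (f : 'rV[R]_n.+1 -> R) (t : R) (v : 'rV[R]_n) i :
  partial i (fun v => f (cons_rV (t, v))) v = partial (lift ord0 i) f (cons_rV (t, v)).
Proof. by rewrite /partial /derive growth_rate_cons_rVS. Qed.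

(** The region [M < |x|] is open, so [f] is zero in a neighbourhood of each of its points. *)
Lemma partial_bounded_supp n (M : R) (f : 'rV[R]_n -> R) i :
  (forall x, M < `|x| -> f x = 0) -> forall x, M < `|x| -> partial i f x = 0.
Proof.
move=> f0 x Mx; rewrite /partial (near_eq_derive _ (_ : \near x, f x = cst 0 x)).
  exact: derive_cst.
by apply: filterS (near_norm_gt Mx) => y; exact: f0.
Qed.

(** Induction on the dimension. Fubini's theorem allows integrating first over the variables that
    contain the [i]-th one; the inner integral is then already zero. *)
Lemma integral_partial_bounded_supp n (i : 'I_n) (M : R) (f : 'rV[R]_n -> R) :
  (forall x, derivable f x (delta_mx ord0 i)) -> continuous (partial i f) ->
  (forall x, M < `|x| -> f x = 0) ->
  (\int[lebesgue_rV R n]_x (partial i f x)%:E = 0)%E.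
Proof.
elim: n i f => [[]//|n IH] i f df cf f0.
have mf := continuous_measurable_rV cf.
have intf := integrable_bounded_supp cf (@partial_bounded_supp _ _ _ i f0).
have intfc := integrable_cons_rV mf intf.
rewrite integral_pushforward//; [|exact: measurable_cons_rV|exact/measurable_EFinP].
rewrite preimage_setT.
case: (unliftP ord0 i) => [j|] iE; rewrite iE in df cf intfc *.
(* Direction other than the first: for fixed first coordinate [t], the slice in the remaining
   variables falls under the induction hypothesis. *)
- rewrite -integral12_prod_meas1//; apply: integral0_eq => t _.
  rewrite /fubini_F; under eq_integral do rewrite /= -partial_cons_rVS.
  apply: IH.
  + by move=> v; apply: derivable_cons_rVS.
  + move=> v; rewrite (_ : partial j _ =
        (fun v => partial (lift ord0 j) f (cons_rV (t, v)))); last first.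
      by apply/funext => w; rewrite partial_cons_rVS.
    apply: (@continuous_comp _ _ _ (fun v => cons_rV (t, v))).
      exact: continuous_cons_rVr.
    exact: cf.
  + by move=> v Mv; rewrite f0// (lt_le_trans Mv)//; exact: cons_rV_normr.
(* First direction: for fixed remaining coordinates [v], the inner integral is the one-dimensional
   case. *)
- rewrite -integral21_prod_meas1//; apply: integral0_eq => v _.
  apply: (@integral_derive_compact_supp _ (fun t => f (cons_rV (t, v))) _ M).
  + by move=> t; exact: is_derive_cons_rV0.
  + move=> t; apply: (@continuous_comp _ _ _ (fun t => cons_rV (t, v))).
      exact: continuous_cons_rVl.
    exact: cf.
  + by move=> t Mt; rewrite f0// (lt_le_trans Mt)//; exact: cons_rV_norml.
Qed.

End gauss.

(** * Differential operators and the Bochner identity *)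

Section vector_calculus.
Context {R : realType} {d : nat}.
Implicit Types (f g U sigma : 'rV[R]_d -> R) (F G : 'rV[R]_d -> 'rV[R]_d).
Implicit Types (u v w : 'rV[R]_d).

Lemma rV_ext u v : (forall i, u ord0 i = v ord0 i) -> u = v.
Proof. by move=> uv; apply/rowP. Qed.

Lemma innerC u v : inner u v = inner v u.
Proof. by apply: eq_bigr => i _; rewrite mulrC. Qed.

Lemma innerDr u v w : inner u (v + w) = inner u v + inner u w.
Proof. by rewrite -big_split; apply: eq_bigr => i _; rewrite mxE mulrDr. Qed.

Lemma innerDl u v w : inner (u + v) w = inner u w + inner v w.
Proof. by rewrite innerC innerDr !(innerC w). Qed.

Lemma innerZr c u v : inner u (c *: v) = c * inner u v.
Proof. by rewrite mulr_sumr; apply: eq_bigr => i _; rewrite mxE mulrCA. Qed.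

Lemma innerZl c u v : inner (c *: u) v = c * inner u v.
Proof. by rewrite innerC innerZr innerC. Qed.

Lemma inner0r u : inner u 0 = 0.
Proof. by apply: big1 => i _; rewrite mxE mulr0. Qed.

Lemma inner0l u : inner 0 u = 0.
Proof. by rewrite innerC inner0r. Qed.

Lemma enorm_sqr u : enorm u ^+ 2 = inner u u.
Proof. by rewrite sqr_sqrtr// sumr_ge0// => i _; rewrite -expr2 sqr_ge0. Qed.

Lemma frobenius_sqr (A : 'M[R]_d) :
  frobenius A ^+ 2 = \sum_(i < d) \sum_(j < d) A i j ^+ 2.
Proof.
have E : \tr (A^T *m A) = \sum_(i < d) \sum_(j < d) A i j ^+ 2.
  rewrite exchange_big; apply: eq_bigr => j _; rewrite !mxE.
  by apply: eq_bigr => i _; rewrite !mxE expr2.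
by rewrite sqr_sqrtr E// !sumr_ge0// => i _; rewrite sumr_ge0// => j _; exact: sqr_ge0.
Qed.

Lemma mxactE (A : 'M[R]_d) v i : mxact A v ord0 i = \sum_(j < d) A i j * v ord0 j.
Proof. by rewrite !mxE; apply: eq_bigr => j _; rewrite !mxE mulrC. Qed.

Lemma inner_mxact_sym (A : 'M[R]_d) u v : A^T = A ->
  inner u (mxact A v) = inner v (mxact A u).
Proof.
move=> sA; rewrite /inner; under eq_bigr => i _ do rewrite mxactE mulr_sumr.
rewrite exchange_big; apply: eq_bigr => i _; rewrite mxactE mulr_sumr.
by apply: eq_bigr => j _; rewrite -[in LHS]sA mxE; ring.
Qed.

Lemma hessian_sym f x : Ck 2 f -> (hessian f x)^T = hessian f x.
Proof. by move=> Cf; apply/matrixP => i j; rewrite !mxE partialC. Qed.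

Definition CkV k F := forall i, Ck k (fun x => F x ord0 i).

Lemma Ck_inner k F G : CkV k F -> CkV k G -> Ck k (fun x => inner (F x) (G x)).
Proof. by move=> CF CG; apply: Ck_sum => i; exact: CkM. Qed.

Lemma CkVZ k f F : Ck k f -> CkV k F -> CkV k (fun x => f x *: F x).
Proof.
move=> Cf CF i; rewrite (_ : (fun x => _) = fun x => f x * F x ord0 i).
  exact: CkM.
by apply/funext => x; rewrite mxE.
Qed.

Lemma CkVD k F G : CkV k F -> CkV k G -> CkV k (fun x => F x + G x).
Proof.
move=> CF CG i; rewrite (_ : (fun x => _) = fun x => F x ord0 i + G x ord0 i).
  exact: CkD.
by apply/funext => x; rewrite mxE.
Qed.

Lemma CkV_grad k f : Ck k.+1 f -> CkV k (grad f).
Proof.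
move=> Cf i; rewrite (_ : (fun x => _) = partial i f); first exact: Ck_partial.
by apply/funext => x; rewrite mxE.
Qed.

Lemma CkV_hessian_act k f F : Ck k.+2 f -> CkV k F ->
  CkV k (fun x => mxact (hessian f x) (F x)).
Proof.
move=> Cf CF i.
rewrite (_ : (fun x => _) =
    fun x => \sum_(j < d) partial i (partial j f) x * F x ord0 j).
  by apply: Ck_sum => j; apply: CkM => //; do 2 apply: Ck_partial.
by apply/funext => x; rewrite mxactE; apply: eq_bigr => j _; rewrite mxE.
Qed.

Lemma Ck_div k F : CkV k.+1 F -> Ck k (div F).
Proof. by move=> CF; apply: Ck_sum => i; exact: Ck_partial. Qed.

Lemma Ck_nabla_star k U F : Ck k.+1 U -> CkV k.+1 F -> Ck k (nabla_star U F).
Proof.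
move=> CU CF; apply: CkD; first exact/CkN/Ck_div.
by apply: Ck_inner; [exact: CkV_grad|move=> i; exact: CkS].
Qed.

Lemma gradE f x i : grad f x ord0 i = partial i f x.
Proof. exact: mxE. Qed.

Lemma hessianE f x i j : hessian f x i j = partial i (partial j f) x.
Proof. exact: mxE. Qed.

Lemma gradM f g x : differentiable f x -> differentiable g x ->
  grad (fun y => f y * g y) x = f x *: grad g x + g x *: grad f x.
Proof. by move=> df dg; apply/rowP => i; rewrite !mxE partialM. Qed.

Lemma gradX f n x : differentiable f x ->
  grad (fun y => f y ^+ n) x = (n%:R * f x ^+ n.-1) *: grad f x.
Proof. by move=> df; apply/rowP => i; rewrite !mxE partialX. Qed.

Lemma grad_inner_grad f g x : Ck 2 f -> Ck 2 g ->
  grad (fun y => inner (grad f y) (grad g y)) x =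
  mxact (hessian f x) (grad g x) + mxact (hessian g x) (grad f x).
Proof.
move=> Cf Cg; have df h j y (Ch : Ck 2 h) : differentiable (partial j h) y.
  exact: Ck_differentiable (Ck_partial j Ch).
apply: rV_ext => i; rewrite gradE [RHS]mxE [X in _ = X + _]mxactE [X in _ = _ + X]mxactE.
rewrite -big_split /=.
rewrite (_ : (fun y => _) = fun y => \sum_j partial j f y * partial j g y); last first.
  by apply/funext => y; apply: eq_bigr => j _; rewrite !gradE.
rewrite partial_sum; last by move=> j; apply: differentiableM; exact: df.
apply: eq_bigr => j _; rewrite partialM; [|exact: df|exact: df].
rewrite !gradE !hessianE; ring.
Qed.

Lemma nabla_starD U F G x : CkV 1 F -> CkV 1 G ->
  nabla_star U (fun y => F y + G y) x = nabla_star U F x + nabla_star U G x.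
Proof.
move=> CF CG; rewrite /nabla_star innerDr.
rewrite (_ : div _ x = div F x + div G x); first ring.
rewrite /div -big_split; apply: eq_bigr => i _.
rewrite (_ : (fun y => _) = fun y => F y ord0 i + G y ord0 i).
  by rewrite partialD//; [exact: Ck_differentiable (CF i)|exact: Ck_differentiable (CG i)].
by apply/funext => y; rewrite mxE.
Qed.

Lemma nabla_starZ U f F x : Ck 1 f -> CkV 1 F ->
  nabla_star U (fun y => f y *: F y) x =
  f x * nabla_star U F x - inner (grad f x) (F x).
Proof.
move=> Cf CF; rewrite /nabla_star innerZr.
rewrite (_ : div _ x = f x * div F x + inner (grad f x) (F x)); first ring.
rewrite /div mulr_sumr -big_split; apply: eq_bigr => i _.
rewrite (_ : (fun y => _) = fun y => f y * F y ord0 i).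
  rewrite partialM; [|exact: Ck_differentiable Cf|exact: Ck_differentiable (CF i)].
  by rewrite mxE; congr (_ + _); rewrite mulrC.
by apply/funext => y; rewrite mxE.
Qed.

(* [T j i] stands for the third derivative d_j d_i d_i g, and [l] for the
   gradient of L_0 g. *)
Lemma bochner_sums (H V : 'M[R]_d) (T : 'I_d -> 'I_d -> R) (a u l : 'rV[R]_d) :
  H^T = H -> V^T = V ->
  (forall j, l ord0 j = \sum_(i < d)
     (T j i - u ord0 i * H j i - a ord0 i * V j i)) ->
  - (\sum_(i < d) \sum_(j < d) (H i j ^+ 2 + a ord0 j * T j i)) +
    inner u (mxact H a) =
  - inner l a - frobenius H ^+ 2 - inner a (mxact V a).
Proof.
move=> /matrixP sH /matrixP sV lE; rewrite frobenius_sqr /inner.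
under [X in _ + X]eq_bigr => i _ do rewrite mxactE mulr_sumr.
under [X in - X - _ - _]eq_bigr => i _ do rewrite lE mulr_suml.
under [X in _ - X]eq_bigr => i _ do rewrite mxactE mulr_sumr.
(* After this exchange the two sides agree summand by summand in [(i, j)], given the symmetry of [H]
   and [V]. *)
rewrite [X in _ = - X - _ - _]exchange_big /=.
apply/eqP; rewrite -subr_eq0; apply/eqP.
rewrite opprD !opprB -!sumrN -!big_split /=.
apply: big1 => i _; rewrite !opprK -sumrN -!big_split /=; apply: big1 => j _.
have := sH i j; have := sV i j; rewrite !mxE => -> ->; ring.
Qed.

(** The product rule gives [d_i d_i d_j g]. Two exchanges, one for [g] and one for [partial i g],
    bring it to [d_j d_i d_i g], the form in which third derivatives occur in the gradient of
    [L_0 g]. *)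
Lemma div_hessian_act g x : Ck 3 g ->
  div (fun y => mxact (hessian g y) (grad g y)) x =
  \sum_(i < d) \sum_(j < d) (hessian g x i j ^+ 2
    + grad g x ord0 j * partial j (partial i (partial i g)) x).
Proof.
move=> Cg; apply: eq_bigr => i _.
rewrite (_ : (fun y => _) = fun y => \sum_j partial i (partial j g) y * partial j g y).
  have d2 j : differentiable (partial i (partial j g)) x.
    exact: Ck_differentiable (Ck_partial i (Ck_partial j Cg)).
  have d1 j : differentiable (partial j g) x by exact: Ck_differentiable (Ck_partial j Cg).
  rewrite partial_sum; last by move=> j; exact: differentiableM.
  apply: eq_bigr => j _; rewrite partialM; [|exact: d2|exact: d1].
  have E : partial i (partial i (partial j g)) x = partial j (partial i (partial i g)) x.
    transitivity (partial i (partial j (partial i g)) x).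
      exact: (f_equal (fun h => partial i h x) (partialC i j (CkS Cg))).
    exact: (f_equal (fun h => h x) (partialC i j (Ck_partial i Cg))).
  rewrite gradE hessianE.
  exact: (f_equal2 +%R (esym (expr2 _)) (f_equal ( *%R _) E)).
by apply/funext => y; rewrite mxactE; apply: eq_bigr => j _; rewrite gradE hessianE.
Qed.

(** This is the formula for [l] that [bochner_sums] assumes, obtained by differentiating [L_0 g] as
    the sum of [d_i d_i g - d_i U d_i g]. *)
Lemma grad_L_0 U g x j : Ck 2 U -> Ck 3 g ->
  grad (L_0 U g) x ord0 j = \sum_(i < d)
    (partial j (partial i (partial i g)) x - grad U x ord0 i * hessian g x j i
     - grad g x ord0 i * hessian U x j i).
Proof.
move=> CU Cg.
have d2 i : differentiable (partial i (partial i g)) x.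
  exact: Ck_differentiable (Ck_partial i (Ck_partial i Cg)).
have d1 i : differentiable (partial i g) x by exact: Ck_differentiable (Ck_partial i Cg).
have dU i : differentiable (partial i U) x by exact: Ck_differentiable (Ck_partial i CU).
have dUg i : differentiable (fun y => partial i U y * partial i g y) x.
  exact: differentiableM.
rewrite gradE (_ : L_0 U g = fun y => \sum_(i < d) (partial i (partial i g) y
    - partial i U y * partial i g y)); last first.
  apply/funext => y; rewrite /L_0 /nabla_star opprD opprK sumrB.
  congr (_ - _).
    by apply: eq_bigr => i _; apply: eq_partial => z; rewrite gradE.
  by apply: eq_bigr => i _; rewrite !gradE.
rewrite partial_sum; last by move=> i; apply: differentiableB; [exact: d2|exact: dUg].
apply: eq_bigr => i _; rewrite partialB; [|exact: d2|exact: dUg].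
rewrite partialM; [|exact: dU|exact: d1].
rewrite opprD addrA.
by rewrite -(gradE U) -(gradE g) -(hessianE g) -(hessianE U).
Qed.

(** Since [H a] is half the gradient of [|grad g|^2], this is Bochner's formula for [L_0]. The third
    derivatives of [g] and the drift term combine into the gradient of [L_0 g]. *)
Lemma bochner U g x : Ck 2 U -> Ck 3 g ->
  nabla_star U (fun y => mxact (hessian g y) (grad g y)) x =
  - inner (grad (L_0 U g) x) (grad g x) - frobenius (hessian g x) ^+ 2
  - inner (grad g x) (mxact (hessian U x) (grad g x)).
Proof.
move=> CU Cg; rewrite /nabla_star div_hessian_act//.
apply: bochner_sums; [exact/hessian_sym/CkS|exact: hessian_sym|].
by move=> j; exact: grad_L_0.
Qed.

End vector_calculus.

(** * Integration against the Gibbs measure *)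

Section gibbs_integral.
Context {R : realType} {d : nat}.
Variables (U : 'rV[R]_d -> R) (cU : continuous U).

Let weight (x : 'rV[R]_d) : R := (fine (partition_function U))^-1 * expR (- U x).

Let weight_ge0 x : 0 <= weight x.
Proof.
rewrite mulr_ge0 ?expR_ge0// invr_ge0 fine_ge0//; apply: integral_ge0 => y _.
by rewrite lee_fin expR_ge0.
Qed.

Let continuous_expRN : continuous (fun x => expR (- U x)).
Proof.
exact: (@Ck_expR _ _ 0 _ (@CkN _ _ 0 _ cU)).
Qed.

Let measurable_weight : measurable_fun setT weight.
Proof.
by apply: measurable_funM => //; exact: continuous_measurable_rV.
Qed.

Let gibbs_weight A : measurable A ->
  gibbs cU A = (\int[lebesgue_rV R d]_(x in A) (weight x)%:E)%E.
Proof.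
move=> mA; rewrite /gibbs -ge0_integralZl//=.
- by apply/measurable_EFinP/measurable_funTS; exact: continuous_measurable_rV.
- rewrite lee_fin invr_ge0 fine_ge0//; apply: integral_ge0 => y _.
  by rewrite lee_fin expR_ge0.
Qed.

Lemma integral_gibbs (f : 'rV[R]_d -> R) : continuous f ->
  (\int[gibbs cU]_x (f x)%:E = \int[lebesgue_rV R d]_x
    (f x * ((fine (partition_function U))^-1 * expR (- U x)))%:E)%E.
Proof.
move=> cf; apply: (@integral_density _ _ _ (lebesgue_rV R d) (gibbs cU) weight) => //.
exact: continuous_measurable_rV.
Qed.

(** A bounded measurable function is integrable against a finite measure. *)
Lemma gibbs_integrable (M : R) (f : 'rV[R]_d -> R) :
  (partition_function U < +oo)%E -> continuous f ->
  (forall x, M < `|x| -> f x = 0) ->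
  (gibbs cU).-integrable setT (EFin \o f).
Proof.
move=> Zoo cf f0; have [C C0 fC] := bounded_supp_bounded cf f0.
apply: measurable_bounded_integrable => //.
- have Z0 : (0 <= partition_function U)%E.
    by apply: integral_ge0 => y _; rewrite lee_fin expR_ge0.
  (* The total mass unfolds to the inverse of [fine Z] times [Z], with [Z] finite. *)
  change ((fine (partition_function U))^-1%:E * partition_function U < +oo)%E.
  by rewrite -[X in (_ * X)%E]fineK ?ge0_fin_numE// -EFinM ltry.
- exact: continuous_measurable_rV.
- exists C; split; first exact: ger0_real.
  by move=> r Cr x _; apply: le_trans (ltW Cr); exact: fC.
Qed.

Lemma integral_nabla_star (M : R) (F : 'rV[R]_d -> 'rV[R]_d) :
  Ck 2 U -> CkV 1 F -> (forall x, M < `|x| -> F x = 0) ->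
  (\int[gibbs cU]_x (nabla_star U F x)%:E = 0)%E.
Proof.
move=> CU CF F0; pose Z := fine (partition_function U).
(* The sign makes the density times [nabla_star U F] equal to the sum of the [partial i (G i)]. *)
pose G i (x : 'rV[R]_d) := - Z^-1 * expR (- U x) * F x ord0 i.
have Ce : Ck 1 (fun x => expR (- U x)) by apply/Ck_expR/CkN/CkS.
have Cw : Ck 1 (fun x => - Z^-1 * expR (- U x)).
  by apply: CkM => //; exact: Ck_cst.
have CG i : Ck 1 (G i) by exact: CkM.
have G0 i x : M < `|x| -> G i x = 0 by move=> /F0; rewrite /G => ->; rewrite mxE mulr0.
rewrite integral_gibbs; last exact: (@Ck_nabla_star _ _ 0 _ _ (CkS CU) CF).
rewrite (_ : (fun x => _) = fun x => (\sum_(i < d) (partial i (G i) x)%:E)%E); last first.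
  apply/funext => x; rewrite sumEFin; congr (_%:E).
  have dU : differentiable U x by exact: Ck_differentiable CU.
  have de : differentiable (fun x => expR (- U x)) x by exact: Ck_differentiable Ce.
  have dF i : differentiable (fun x => F x ord0 i) x by exact: Ck_differentiable (CF i).
  rewrite /nabla_star /div /inner -sumrN -big_split /= mulr_suml.
  apply: eq_bigr => i _; rewrite gradE /G.
  rewrite partialM; [|exact: Ck_differentiable Cw|exact: dF].
  rewrite partialM; [|exact: differentiable_cst|exact: de].
  rewrite partial_cst partial_expR; last exact: differentiableN.
  rewrite partialN//.
  move: (partial i (fun y => F y ord0 i) x) (partial i U x) => a b.
  by rewrite -/Z; ring.
rewrite integral_sum//; last first.
  move=> i; apply: (@integrable_bounded_supp _ _ M).
    exact: (Ck_partial i (CG i)).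
  exact: (@partial_bounded_supp _ _ _ _ i (G0 i)).
rewrite big1// => i _.
apply: (@integral_partial_bounded_supp _ _ _ M) => //.
- by move=> x; apply/diff_derivable/(Ck_differentiable (k := 0)).
- exact: (Ck_partial i (CG i)).
- exact: G0.
Qed.

End gibbs_integral.

(** The natural power is first turned into the real power, which cancels the root in the norm. The
    norm may be infinite, hence the case analysis. *)
Lemma Lnorm2_sqr d (T : measurableType d) (R : realType)
    (mu : {measure set T -> \bar R}) (f : T -> R) :
  ('N[mu]_2%:E [EFin \o f] ^+ 2 = \int[mu]_x (f x ^+ 2)%:E)%E.
Proof.
transitivity ('N[mu]_2%:E [EFin \o f] `^ 2)%E.
  have := @Lnorm_ge0 _ _ _ mu 2%:E (EFin \o f).
  case: ('N[mu]_2%:E [EFin \o f])%E => [r| |]//; last by rewrite poweRyr// expe2 mulyy.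
  by rewrite lee_fin => r0; rewrite poweR_EFin powR_mulrn// EFin_expe.
rewrite poweR_Lnorm//; apply: eq_integral => x _.
have -> : (`|(EFin \o f) x| = `|f x|%:E)%E by [].
by rewrite poweR_EFin powR_mulrn// real_normK// num_real.
Qed.

(** * The divergence identity *)

Section bochner_field.
Context {R : realType} {d : nat}.
Variables (U sigma g : 'rV[R]_d -> R).
Hypotheses (CU : Ck 2 U) (Cs : Ck 2 sigma) (Cg : Ck 3 g).

Let Cg2 : Ck 2 g. Proof. exact: CkS. Qed.

Let ds x : differentiable sigma x. Proof. exact: Ck_differentiable Cs. Qed.

Lemma grad_cst (c : R) (x : 'rV[R]_d) : grad (fun=> c) x = 0.
Proof. by apply: rV_ext => i; rewrite gradE mxE; exact: partial_cst. Qed.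

Lemma nabla_star_scale (V : 'rV[R]_d -> R) c (F : 'rV[R]_d -> 'rV[R]_d) x :
  CkV 1 F -> nabla_star V (fun y => c *: F y) x = c * nabla_star V F x.
Proof.
move=> CF; rewrite (nabla_starZ _ _ (Ck_cst 1 c) CF).
by rewrite grad_cst inner0l subr0.
Qed.

Lemma nabla_star_grad (V f : 'rV[R]_d -> R) x : nabla_star V (grad f) x = - L_0 V f x.
Proof. by rewrite /L_0 opprK. Qed.

Lemma L_0E (V f : 'rV[R]_d -> R) x :
  L_0 V f x = laplacian f x - inner (grad f x) (grad V x).
Proof. by rewrite /L_0 /nabla_star opprD opprK innerC. Qed.

Lemma L_sigmaE x : L_sigma U sigma g x =
  sigma x ^+ 2 * L_0 U g x + 2 * sigma x * inner (grad sigma x) (grad g x).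
Proof.
rewrite /L_sigma (nabla_starZ _ _ (CkX 2 (CkS Cs)) (CkV_grad Cg2)).
rewrite nabla_star_grad (gradX _ (ds x)) innerZl; ring.
Qed.

Let f1 x := sigma x ^+ 4 * L_0 U g x.
Let f2 x := sigma x ^+ 4.
Let f3 x := sigma x ^+ 3 * inner (grad g x) (grad g x).
Let f4 x := sigma x ^+ 3 * inner (grad g x) (grad sigma x).

Let CL : Ck 1 (L_0 U g).
Proof. exact: (CkN (Ck_nabla_star CU (CkV_grad Cg))). Qed.
Let Cf1 : Ck 1 f1. Proof. exact: (CkM (CkX 4 (CkS Cs)) CL). Qed.
Let Cf2 : Ck 1 f2. Proof. exact: (CkX 4 (CkS Cs)). Qed.
Let Cf3 : Ck 1 f3.
Proof.
exact: (CkM (CkX 3 (CkS Cs)) (Ck_inner (CkV_grad Cg2) (CkV_grad Cg2))).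
Qed.
Let Cf4 : Ck 1 f4.
Proof.
exact: (CkM (CkX 3 (CkS Cs)) (Ck_inner (CkV_grad Cg2) (CkV_grad Cs))).
Qed.

(** The first two terms already give the identity, with remainder
    [4 sigma^3 <s, H a> + 4 sigma^2 <a, s>^2] in place of [Theta]; the last two turn this remainder
    into [Theta]. The grouping and the outer scalars fit [nabla_starD] and [nabla_star_scale]. *)
Definition bochner_field x :=
  (f1 x *: grad g x + -1 *: (f2 x *: mxact (hessian g x) (grad g x))) +
  (-1 *: (f3 x *: grad sigma x) + 2 *: (f4 x *: grad g x)).

Let CF1 : CkV 1 (fun x => f1 x *: grad g x).
Proof. exact: (CkVZ Cf1 (CkV_grad Cg2)). Qed.
Let CF2 : CkV 1 (fun x => f2 x *: mxact (hessian g x) (grad g x)).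
Proof. exact: (CkVZ Cf2 (CkV_hessian_act Cg (CkV_grad Cg2))). Qed.
Let CF3 : CkV 1 (fun x => f3 x *: grad sigma x).
Proof. exact: (CkVZ Cf3 (CkV_grad Cs)). Qed.
Let CF4 : CkV 1 (fun x => f4 x *: grad g x).
Proof. exact: (CkVZ Cf4 (CkV_grad Cg2)). Qed.

Let CkV_scale k (c : R) (F : 'rV[R]_d -> 'rV[R]_d) : CkV k F -> CkV k (fun x => c *: F x).
Proof. exact: (CkVZ (Ck_cst k c)). Qed.

Let CF12 := CkVD CF1 (CkV_scale (-1) CF2).
Let CF34 := CkVD (CkV_scale (-1) CF3) (CkV_scale 2 CF4).

Lemma CkV_bochner_field : CkV 1 bochner_field.
Proof. exact: (CkVD CF12 CF34). Qed.

Lemma nabla_star_bochner_field x :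
  L_sigma U sigma g x ^+ 2 =
  sigma x ^+ 4 * inner (grad g x) (mxact (hessian U x) (grad g x)) +
  sigma x ^+ 4 * frobenius (hessian g x) ^+ 2 + Theta U sigma g x -
  nabla_star U bochner_field x.
Proof.
have Cgg := Ck_inner (CkV_grad Cg2) (CkV_grad Cg2).
have Cgs := Ck_inner (CkV_grad Cg2) (CkV_grad Cs).
rewrite /bochner_field (nabla_starD _ _ CF12 CF34).
rewrite (nabla_starD _ _ CF1 (CkV_scale (-1) CF2)).
rewrite (nabla_starD _ _ (CkV_scale (-1) CF3) (CkV_scale 2 CF4)).
rewrite (nabla_star_scale _ _ _ CF2) (nabla_star_scale _ _ _ CF3).
rewrite (nabla_star_scale _ _ _ CF4).
rewrite (nabla_starZ _ _ Cf1 (CkV_grad Cg2)).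
rewrite (nabla_starZ _ _ Cf2 (CkV_hessian_act Cg (CkV_grad Cg2))).
rewrite (nabla_starZ _ _ Cf3 (CkV_grad Cs)).
rewrite (nabla_starZ _ _ Cf4 (CkV_grad Cg2)).
rewrite (bochner _ CU Cg) !nabla_star_grad.
have dX n : differentiable (fun y => sigma y ^+ n) x.
  exact: (Ck_differentiable x (CkX n Cs)).
rewrite (gradM (dX 4) (Ck_differentiable x CL)).
rewrite (gradM (dX 3) (Ck_differentiable x Cgg)).
rewrite (gradM (dX 3) (Ck_differentiable x Cgs)).
rewrite !(gradX _ (ds x)) (grad_inner_grad x Cg2 Cg2) (grad_inner_grad x Cg2 Cs).
rewrite !(innerDl, innerZl) L_sigmaE /Theta !enorm_sqr /f1 /f2 /f3 /f4.
(* [Theta] contains the Laplacian of [sigma] and [<s, grad U>] separately, so [L_0 U sigma] is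
   expanded, while [L_0 U g] stays whole. *)
rewrite (L_0E U sigma).
(* With all vectors, matrices and scalars abstracted, what remains is a polynomial identity in inner
   products, up to their symmetry and [<a, H s> = <s, H a>]. *)
move: (hessian_sym x Cg2); move: (hessian g x) (hessian sigma x) (hessian U x).
move: (grad (L_0 U g) x) (L_0 U g x) (laplacian sigma x) (grad g x).
move: (grad sigma x) (grad U x) (sigma x) => s u c l L D a H S V sH.
rewrite !(innerC _ a) !(innerC _ s) (inner_mxact_sym a s sH).
ring.
Qed.

(** The third term vanishes through the factor [|grad g|^2] in [f3], the others through their
    vector. The field thus inherits bounded support from [g]. *)
Lemma bochner_field0 x : grad g x = 0 -> bochner_field x = 0.
Proof.
move=> g0; rewrite /bochner_field /f3 g0 !scaler0 inner0r mulr0 scale0r scaler0.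
by rewrite /mxact mul0mx !(scaler0, addr0).
Qed.

End bochner_field.

(** * Integration of the pointwise identity *)

Lemma compactly_supported_bounded (R : realType) d (f : 'rV[R]_d -> R) :
  compactly_supported f -> exists M, forall x, M < `|x| -> f x = 0.
Proof.
(* [MP] bounds the support by every radius strictly above [M], in particular by [M + 1]. *)
move=> /compact_bounded[M [_ MP]]; exists (M + 1) => x Mx.
apply/eqP/negP => /negP fx.
have := MP (M + 1); rewrite ltrDl ltr01 => /(_ isT x).
have : closure [set x | f x != 0] x by exact: subset_closure.
by move=> /[swap] /[apply] /=; rewrite leNgt Mx.
Qed.

Theorem lemma4p1 (R : realType) (d : nat) (hd : (1 <= d)%N)
    (U : 'rV[R]_d -> R) (hU : smooth U)
    (hZ : (0 < partition_function U < +oo)%E)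
    (sigma : 'rV[R]_d -> R) (hsigma1 : forall x, 1 <= sigma x)
    (hsigma : smooth sigma) (hsigma_lip : lipschitz sigma)
    (g : 'rV[R]_d -> R) (hg : Ck 3 g) (hg_supp : compactly_supported g) :
  let mu := gibbs (smooth_continuous hU) in
  ('N[mu]_2%:E [EFin \o L_sigma U sigma g] ^+ 2 =
   \int[mu]_x (sigma x ^+ 4 *
     inner (grad g x) (mxact (hessian U x) (grad g x)))%:E +
   \int[mu]_x (sigma x ^+ 4 * frobenius (hessian g x) ^+ 2)%:E +
   \int[mu]_x (Theta U sigma g x)%:E)%E.
Proof.
move=> mu; have CU := hU 2%N; have Cs := hsigma 2%N.
have [M g0] := compactly_supported_bounded hg_supp.
have dg0 i x : M < `|x| -> partial i g x = 0 by exact: partial_bounded_supp g0 x.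
have grad0 x : M < `|x| -> grad g x = 0.
  by move=> Mx; apply: rV_ext => i; rewrite gradE mxE; exact: dg0.
have hess0 x : M < `|x| -> hessian g x = 0.
  move=> Mx; apply/matrixP => i j; rewrite hessianE mxE.
  exact: (partial_bounded_supp i (dg0 j) Mx).
have [_ Zoo] := andP hZ.
have Cg2 := CkS hg.
have cgr0 : CkV 0 (grad g) by move=> i; exact: CkS (CkV_grad Cg2 i).
have csr0 : CkV 0 (grad sigma) by move=> i; exact: CkS (CkV_grad Cs i).
have cUr0 : CkV 0 (grad U) by move=> i; exact: CkS (CkV_grad CU i).
have cs0 : Ck 0 sigma := hsigma 0%N.
have cT1 : Ck 0 (fun x => sigma x ^+ 4 *
    inner (grad g x) (mxact (hessian U x) (grad g x))).
  exact: (CkM (CkX 4 cs0) (Ck_inner cgr0 (CkV_hessian_act CU cgr0))).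
have cT2 : Ck 0 (fun x => sigma x ^+ 4 * frobenius (hessian g x) ^+ 2).
  apply: (CkM (CkX 4 cs0)).
  rewrite (_ : (fun x => _) = fun x =>
      \sum_(i < d) \sum_(j < d) partial i (partial j g) x ^+ 2).
    apply: Ck_sum => i; apply: Ck_sum => j.
    exact: (CkX 2 (Ck_partial i (Ck_partial j Cg2))).
  apply/funext => x; rewrite frobenius_sqr; apply: eq_bigr => i _.
  by apply: eq_bigr => j _; rewrite hessianE.
have CF := CkV_bochner_field CU Cs hg.
have cN : Ck 0 (nabla_star U (bochner_field U sigma g)).
  exact: Ck_nabla_star (CkS CU) CF.
have F0 x : M < `|x| -> bochner_field U sigma g x = 0.
  by move=> /grad0; exact: bochner_field0.
have N0 x : M < `|x| -> nabla_star U (bochner_field U sigma g) x = 0.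
  move=> Mx; rewrite /nabla_star (F0 x Mx) inner0r addr0 /div big1 ?oppr0// => i _.
  apply: (@partial_bounded_supp _ _ M) => // y My.
  by rewrite (F0 y My) mxE.
have bochnerE := nabla_star_bochner_field CU Cs hg.
have cL : Ck 0 (L_sigma U sigma g).
  apply: CkN; apply: (Ck_nabla_star (CkS CU)).
  exact: (CkVZ (CkX 2 (CkS Cs)) (CkV_grad Cg2)).
(* Continuity of [Theta] is read off from the pointwise identity, whose other terms are known to be
   continuous. *)
have cT3 : Ck 0 (Theta U sigma g).
  rewrite (_ : Theta U sigma g = fun x => L_sigma U sigma g x ^+ 2
      + nabla_star U (bochner_field U sigma g) x
      - (sigma x ^+ 4 * inner (grad g x) (mxact (hessian U x) (grad g x))
         + sigma x ^+ 4 * frobenius (hessian g x) ^+ 2)).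
    exact: (CkD (CkD (CkX 2 cL) cN) (CkN (CkD cT1 cT2))).
  by apply/funext => x; rewrite bochnerE subrK addrC addKr.
have T10 x : M < `|x| -> sigma x ^+ 4 *
    inner (grad g x) (mxact (hessian U x) (grad g x)) = 0.
  by move=> /grad0 ->; rewrite inner0l mulr0.
have T20 x : M < `|x| -> sigma x ^+ 4 * frobenius (hessian g x) ^+ 2 = 0.
  move=> /hess0 ->; rewrite frobenius_sqr big1 ?mulr0// => i _.
  by rewrite big1// => j _; rewrite mxE expr0n.
have T30 x : M < `|x| -> Theta U sigma g x = 0.
  move=> /grad0 gx; rewrite /Theta enorm_sqr (enorm_sqr (grad g x)) gx.
  by rewrite !inner0l /mxact mul0mx inner0r expr0n !(mulr0, mul0r, addr0, subr0).
(* Each integrand is continuous and zero beyond radius [M], hence integrable; this justifies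
   splitting the integral of the sum. *)
have iT1 := @gibbs_integrable _ _ _ (smooth_continuous hU) _ _ Zoo cT1 T10.
have iT2 := @gibbs_integrable _ _ _ (smooth_continuous hU) _ _ Zoo cT2 T20.
have iT3 := @gibbs_integrable _ _ _ (smooth_continuous hU) _ _ Zoo cT3 T30.
have iN := @gibbs_integrable _ _ _ (smooth_continuous hU) _ _ Zoo cN N0.
have iT12 := integrableD measurableT iT1 iT2.
have iT := integrableD measurableT iT12 iT3.
(* The pointwise identity is inserted under the integral; the [nabla_star] term integrates to zero
   and linearity separates the other three. *)
rewrite Lnorm2_sqr; under eq_integral do rewrite bochnerE EFinB.
rewrite integralB_EFin// (integral_nabla_star _ CU CF F0) sube0.
rewrite -integralD_EFin// -integralD_EFin//.
Qed.
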